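(* Let $\Gamma$ and $\Lambda$ be finitely generated groups, let $\varphi\colon(0,\infty)\to(0,\infty)$ be a non-decreasing function, and assume that there exists a $(\varphi,\mathrm L^0)$-integrable measure equivalence coupling from $\Gamma$ to $\Lambda$. Then: \begin{itemize} \item if $\varphi(t)=t$, then $\mathrm{F\o l}_\Gamma\preccurlyeq \mathrm{F\o l}_\Lambda$; \item if $\varphi$ and $t\mapsto t/\varphi(t)$ are increasing, then $\mathrm{F\o l}_\Gamma\circ\varphi\preccurlyeq \mathrm{F\o l}_\Lambda$. \end{itemize}
   Context: Fix finite symmetric generating sets $S_\Gamma$, $S_\Lambda$; $|\cdot|_{S}$ denotes word length. Følner function. For a finitely generated group $G$ with finite symmetric generating set $S_G$ and a real $k>0$, $$\mathrm{F\o l}_G(k)=\inf\left\{|A|\colon A\subseteq G \text{ finite nonempty},\ \frac{|\partial A|}{|A|}\leq \frac1k\right\},\qquad \partial A=S_GA\bigtriangleup A,$$ with $\inf\emptyset=+\infty$. Asymptotic comparison. For monotone functions, $f\preccurlyeq g$ means that there is a constant $C>0$ with $f(n)=O(g(Cn))$ as $n\to\infty$. Measure equivalence couplings. A measure equivalence coupling from $\Gamma$ to $\Lambda$ is a quadruple $(\Omega,X_\Gamma,X_\Lambda,\mu)$, where $(\Omega,\mu)$ is a standard Borel space with a nonzero $\sigma$-finite measure, equipped with commuting, free (up to null sets), measure-preserving actions of $\Gamma$ and $\Lambda$, denoted $*$, and $X_\Gamma$, $X_\Lambda$ are Borel fundamental domains of finite measure for the $\Gamma$-action and the $\Lambda$-action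 respectively (a fundamental domain is a Borel set meeting almost every orbit in exactly one point). The group $\Gamma$ acts on $X_\Lambda$ by $\{\gamma\cdot x\}=(\Lambda*\gamma*x)\cap X_\Lambda$, and the cocycle $\alpha\colon\Gamma\times X_\Lambda\to\Lambda$ is defined by $\alpha(\gamma,x)*\gamma*x=\gamma\cdot x$. The coupling is $(\varphi,\mathrm L^0)$-integrable if for every $\gamma\in\Gamma$ there is $c_\gamma>0$ with $$\int_{X_\Lambda}\varphi\left(\frac{|\alpha(\gamma,x)|_{S_\Lambda}}{c_\gamma}\right)d\mu(x)<\infty$$ (no condition is imposed in the other direction). Since $\varphi$ is only defined on $(0,\infty)$, $\varphi(0)$ may be given any value in $[0,\inf\varphi]$; this is irrelevant as $\mu(X_\Lambda)<\infty$. *)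

(* Defs.v *)
From HB Require Import structures.
From mathcomp Require Import all_boot all_order all_algebra finmap.
From mathcomp Require Import all_classical all_reals all_analysis.

Set Implicit Arguments.
Unset Strict Implicit.
Unset Printing Implicit Defensive.
Import Order.TTheory GRing.Theory Num.Theory.

Local Open Scope classical_set_scope.
Local Open Scope group_scope.
Local Open Scope ring_scope.

Section WordMetric.
Variable G : groupType.
Implicit Types (S A : {fset G}) (g : G).

(* [{pred G}] ranges over all subsets of [G], by classical logic. *)
Definition generates S : Prop :=
  forall H : {pred G}, group_closed H -> {subset S <= H} -> forall g, g \in H.

Definition symmetric_fset S : Prop :=
  forall s, s \in S -> (s^-1)%g \in S.

Definition finite_symmetric_generating S : Prop :=
  symmetric_fset S /\ generates S.

Definition is_word S g (n : nat) : Prop :=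
  exists w : seq G,
    [/\ size w = n, {subset w <= S} & (\prod_(s <- w) s)%g = g].

(* The default value 0 is never used when [S] is symmetric and generates [G]. *)
Definition word_length S g : nat :=
  xget 0%N [set n | is_word S g n /\ forall m, is_word S g m -> (n <= m)%N].

Definition translates S A : {fset G} := [fset (s * a)%g | s in S, a in A]%fset.

Definition boundary S A : {fset G} :=
  ((translates S A `\` A) `|` (A `\` translates S A))%fset.

(* Only the values at [0 < k] are meaningful. *)
Definition folner (R : realType) S (k : R) : \bar R :=
  ereal_inf [set (#|` A|%:R)%:E | A in
    [set A : {fset G} | A != fset0 /\
                        #|` boundary S A|%:R / #|` A|%:R <= 1 / k]].

End WordMetric.

(* Since Foelner functions are [\bar R]-valued, the library's [=O] (for functions
   into normed modules) does not apply; [K] is the constant of the O. *)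
Definition asymp_le (R : realType) (f g : R -> \bar R) : Prop :=
  exists2 C : R, 0 < C &
  exists2 K : R, 0 < K &
    \forall n \near +oo, (f n <= K%:E * g (C * n)%R)%E.

(* The sigma-algebra is the Borel sigma-algebra of a Polish space. *)
Definition standard_borel (R : realType) d (T : measurableType d) : Prop :=
  exists (P : completePseudoMetricType R) (f : T -> P),
    [/\ hausdorff_space P,
        exists2 D : set P, countable D & dense D,
        bijective f &
        forall A : set T, measurable A <-> <<s @open P >> (f @` A)].

Section Actions.
Variables (R : realType) (d : measure_display) (T : measurableType d).
Variable mu : {measure set T -> \bar R}.
Variable G : groupType.
Implicit Type a : G -> T -> T.

Definition is_group_action a : Prop :=
  (forall x, a 1%g x = x) /\ (forall g h x, a (g * h)%g x = a g (a h x)).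

Definition preserves_measure a : Prop :=
  forall g, measurable_fun setT (a g) /\
    forall A, measurable A -> mu (a g @^-1` A) = mu A.

Definition essentially_free a : Prop :=
  {ae mu, forall x, forall g, a g x = x -> g = 1%g}.

Definition orbit_of a (x : T) : set T := [set a g x | g in setT].

Definition fundamental_domain a (X : set T) : Prop :=
  measurable X /\ {ae mu, forall x, exists! y, (orbit_of a x `&` X) y}.

End Actions.

Record me_coupling (R : realType) (G L : groupType) := MECoupling {
  me_display : measure_display;
  me_space : measurableType me_display;
  me_measure : {measure set me_space -> \bar R};
  me_actG : G -> me_space -> me_space;
  me_actL : L -> me_space -> me_space;
  me_domG : set me_space;
  me_domL : set me_space;
  me_standard : standard_borel R me_space;
  me_sigma_finite : sigma_finite setT me_measure;
  me_nonzero : me_measure setT <> 0%E;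
  me_actGP : is_group_action me_actG;
  me_actLP : is_group_action me_actL;
  me_commute : forall g l x, me_actG g (me_actL l x) = me_actL l (me_actG g x);
  me_preservesG : preserves_measure me_measure me_actG;
  me_preservesL : preserves_measure me_measure me_actL;
  me_freeG : essentially_free me_measure me_actG;
  me_freeL : essentially_free me_measure me_actL;
  me_domGP : fundamental_domain me_measure me_actG me_domG;
  me_domLP : fundamental_domain me_measure me_actL me_domL;
  me_domG_fin : (me_measure me_domG < +oo)%E;
  me_domL_fin : (me_measure me_domL < +oo)%E
}.

Arguments me_actG {R G L} m _ _.
Arguments me_actL {R G L} m _ _.
Arguments me_domG {R G L} m _.
Arguments me_domL {R G L} m _.
Arguments me_measure {R G L} m.

Section Cocycle.
Variables (R : realType) (G L : groupType) (c : me_coupling R G L).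

(* The induced action and the cocycle are only determined almost everywhere;
   outside the conull set where the defining conditions have a unique solution
   they take the default values [x] and [1]. *)
Definition induced_act (g : G) (x : me_space c) : me_space c :=
  xget x [set y | [set y] = orbit_of (me_actL c) (me_actG c g x)
                            `&` me_domL c].

Definition cocycle (g : G) (x : me_space c) : L :=
  xget 1%g [set l |
    unique (fun l' => me_actL c l' (me_actG c g x) = induced_act g x) l].

Definition phi_integrable (S : {fset L}) (phi : R -> R) : Prop :=
  forall g : G, exists2 cg : R, 0 < cg &
    (\int[me_measure c]_(x in me_domL c)
       (phi ((word_length S (cocycle g x))%:R / cg))%:E < +oo)%E.

End Cocycle.

(* Main.v *)
(* Let X, Y be the fundamental domains of Lam, Gam in the coupling space. Given a
   Foelner set A of Lam, put U := {x | l x \in X for some l \in A}, a set of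
   measure |A| mu(X), and for x in Y let B_x := {g | g x \in U}, a subset of Gam.
   Integrating over Y, the average of |B_x| is mu(U), and the average of
   #{b \in B_x | s b \notin B_x} is mu {x \in U | s x \notin U}, at most the
   integral over X of |alpha(s,x) A \ A| <= min(|A|, |alpha(s,x)| |boundary A|).
   If A has boundary ratio 1/(C n), splitting according to
   |alpha(s,x)| / c_s <= n bounds this integral by a small multiple of
   |A| / phi(n), once C and then n are large: t / phi(t) controls the first part,
   the tail of the integral of phi the second. Hence most of the mass of U sits
   over x with |boundary B_x| <= |B_x| / phi(n).

   To get |B_x| = O(|A|) at the same time, note that |B_x| is the sum over l in A
   of N(l x), where N counts the points of a Gam-orbit in X. As N is integrable
   on Y, these sums divided by |A| are uniformly integrable in A, so for m large
   only a small part of the mass lies over x with |B_x| > 2 m |A|. *)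
Require Import Defs.
From HB Require Import structures.
From mathcomp Require Import all_boot all_order all_algebra finmap.
From mathcomp Require Import all_classical all_reals all_analysis.
From mathcomp Require Import measurable_realfun ring lra.
Set Implicit Arguments.
Unset Strict Implicit.
Unset Printing Implicit Defensive.
Import Order.TTheory GRing.Theory Num.Theory.
Local Open Scope classical_set_scope.
Local Open Scope ring_scope.

(** * Translates and boundaries in groups *)

Section Groups.
Variable G : groupType.
Implicit Types (S A : {fset G}) (g h s : G).

(* In bijection with g A \ A. *)
Definition exits A g : {fset G} := [fset a in A | (g * a)%g \notin A]%fset.

Lemma card_lmulg g A : #|` [fset (g * a)%g | a in A]%fset| = #|` A|.
Proof. by rewrite card_imfset//; exact: mulgI. Qed.

Lemma card_exits_le A g : (#|` exits A g| <= #|` A|)%N.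
Proof. by apply: fsubset_leq_card; exact: fset_sub. Qed.

Lemma card_exits1 A : #|` exits A 1%g| = 0%N.
Proof.
apply/eqP; rewrite cardfs_eq0; apply/eqP/fsetP => a.
by rewrite !inE mul1g; case: (a \in A).
Qed.

(** Suppose a lies in A and g h a does not. If h a is in A, it is an exit of g, and left translation
    by h is injective; otherwise a itself is an exit of h. *)
Lemma card_exitsM A g h :
  (#|` exits A (g * h)%g| <= #|` exits A g| + #|` exits A h|)%N.
Proof.
pose E := [fset a in exits A (g * h)%g | (h * a)%g \in A]%fset.
have E_g : (#|` E| <= #|` exits A g|)%N.
  rewrite -(card_lmulg h).
  apply/fsubset_leq_card/fsubsetP => _ /imfsetP[a /= aE ->].
  by move: aE; rewrite !inE/= mulgA => /andP[/andP[_ ->] ->].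
have sub : (exits A (g * h)%g `<=` E `|` exits A h)%fset.
  apply/fsubsetP => a; rewrite !inE => /andP[-> ->] /=.
  by rewrite orbN.
apply: leq_trans (fsubset_leq_card sub) _.
apply: leq_trans (leq_card_fsetU _ _) _.
by rewrite leq_add2r.
Qed.

(** Left multiplication by s injects the exits into the outer part S A \ A of the boundary. *)
Lemma card_exits_gen S A s : s \in S -> (#|` exits A s| <= #|` boundary S A|)%N.
Proof.
move=> sS; rewrite -(card_lmulg s).
apply/fsubset_leq_card/fsubsetP => _ /imfsetP[a /= aE ->].
move: aE; rewrite !inE => /andP[aA saA].
rewrite (negbTE saA)/= andbF orbF; apply/imfset2P.
by exists s => //; exists a.
Qed.

Lemma card_exits_word S A g n :
  is_word S g n -> (#|` exits A g| <= n * #|` boundary S A|)%N.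
Proof.
move=> [w [<- + <-]] {g n}; elim: w => [_|s w IH wS].
  by rewrite big_nil card_exits1.
rewrite big_cons mulSn (leq_trans (card_exitsM _ _ _))// leq_add//.
  by apply: card_exits_gen; apply: wS; rewrite inE eqxx.
by apply: IH => t tw; apply: wS; rewrite inE tw orbT.
Qed.

(** The outer part S A \ A is covered by the sets s ([exits A s]). The inner part A \ S A is
    contained in A \ s0 A for any s0 in S, whence the factor 2 and the need for a generator. *)
Lemma card_boundary_exits S A : S != fset0 ->
  (#|` boundary S A| <= (\sum_(s <- S) #|` exits A s|).*2)%N.
Proof.
move=> /fset0Pn[s0 s0S].
have le1 : (#|` translates S A `\` A| <= \sum_(s <- S) #|` exits A s|)%fset%N.
  have sub : (translates S A `\` A `<=`
      \bigcup_(s <- S) [fset (s * a)%g | a in exits A s])%fset.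
    apply/fsubsetP => b; rewrite !inE => /andP[bA /imfset2P[s /= sS [a /= aA bE]]].
    apply/bigfcupP; exists s; rewrite ?sS//.
    apply/imfsetP; exists a => //=.
    by rewrite !inE aA -bE.
  apply: leq_trans (fsubset_leq_card sub) _.
  elim: (enum_fset S) => [|s r IH]; first by rewrite !big_nil cardfs0.
  rewrite !big_cons (leq_trans (leq_card_fsetU _ _))// leq_add//.
  by rewrite card_lmulg.
have le2 : (#|` A `\` translates S A| <= #|` exits A s0|)%fset%N.
  (* Complements are compared instead: s0 maps the points of A that stay in A injectively into A [&]
     S A. *)
  have -> : #|` exits A s0| =
      (#|` A| - #|` [fset a in A | (s0 * a)%g \in A]|)%fset%N.
    have -> : exits A s0 = (A `\` [fset a in A | (s0 * a)%g \in A])%fset.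
      by apply/fsetP => a; rewrite !inE; case: (a \in A); rewrite ?andbF ?andbT.
    by rewrite cardfsD (fsetIidPr _)// fset_sub.
  rewrite cardfsD leq_sub2l//.
  rewrite -(card_lmulg s0).
  apply/fsubset_leq_card/fsubsetP => _ /imfsetP[a /= aE ->].
  move: aE; rewrite !inE/= => /andP[aA ->]; apply/imfset2P.
  by exists s0 => //; exists a.
have le3 : (#|` exits A s0| <= \sum_(s <- S) #|` exits A s|)%N.
  by rewrite (big_fsetD1 _ s0S)/= leq_addr.
rewrite /boundary (leq_trans (leq_card_fsetU _ _))// -addnn leq_add//.
exact: leq_trans le3.
Qed.

(** * Word length and countability of finitely generated groups *)

Section Generated.
Variable S : {fset G}.
Hypothesis hS : finite_symmetric_generating S.

Lemma generating_word g : exists n, is_word S g n.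
Proof.
(* The elements spelled by words form a subgroup containing S: the inverse of a word is the reversed
   word of inverses, still over S by symmetry. *)
pose H : {pred G} := [pred x | `[< exists n, is_word S x n >]].
suff : g \in H by move=> /asboolP.
case: hS => symS; apply; last first.
  move=> s sS; apply/asboolP; exists 1%N, [:: s]; split => //=.
    by move=> t; rewrite inE => /eqP ->.
  by rewrite big_seq1.
split; first by apply/asboolP; exists 0%N, [::]; split => //; rewrite big_nil.
move=> x y /asboolP[n [v [_ vS <-]]] /asboolP[m [w [_ wS <-]]].
apply/asboolP; exists (size (v ++ rev (map (fun t : G => t^-1)%g w))).
exists (v ++ rev (map (fun t : G => t^-1)%g w)); split => //.
  move=> t; rewrite mem_cat mem_rev => /orP[/vS//|/mapP[u uw ->]].
  by apply: symS; exact: wS.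
rewrite big_cat/=; congr (_ * _)%g.
elim: w {wS} => [|u w IH]; first by rewrite !big_nil invg1.
by rewrite big_cons invgM/= rev_cons -cats1 big_cat big_seq1/= IH.
Qed.

Lemma word_lengthP g : is_word S g (word_length S g).
Proof.
rewrite /word_length; case: xgetP => [n _ []//|H].
have [n gn] := generating_word g.
have ex : exists n, `[< is_word S g n >] by exists n; apply/asboolP.
case: (ex_minnP ex) => m /asboolP gm minm; case: (H m); split => // k gk.
by apply: minm; apply/asboolP.
Qed.

Lemma card_exits_word_length A g :
  (#|` exits A g| <= word_length S g * #|` boundary S A|)%N.
Proof. exact/card_exits_word/word_lengthP. Qed.

Lemma countable_generated : countable [set: G].
Proof.
pose f (w : seq S) : G := (\prod_(s <- map val w) s)%g.
apply: (@sub_countable _ _ _ [set: seq S]); last exact: countableP.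
apply/(card_le_trans _ (card_image_le f setT))/subset_card_le => g _.
have [n [w [_ wS wg]]] := generating_word g.
exists (pmap insub w) => //; rewrite /f -wg; congr (\prod_(s <- _) s)%g.
elim: w wS {wg} => //= s w IH wS.
have sS : s \in S by apply: wS; rewrite inE eqxx.
rewrite insubT/=; congr cons; apply: IH => t tw.
by apply: wS; rewrite inE tw orbT.
Qed.

End Generated.
End Groups.

(** * Sums over countable index sets *)

Section CountableSums.
Local Open Scope ereal_scope.
Variables (R : realType) (I : choiceType).
Hypothesis cI : countable [set: I].

(** The inverse of an injection into [nat], defined on its range D. Indexing by D rather than by all
    of [nat] covers finite I too; i0 is only the default of [xget]. *)
Lemma countable_enum (i0 : I) :
  exists (D : set nat) (e : nat -> I), set_bij D [set: I] e.
Proof.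
have /countable_injP[f injf] := cI.
have eK i : xget i0 [set j | f j = f i] = i.
  by case: xgetP => [j -> /= /injf|/(_ i)/=//]; apply; rewrite inE.
exists (range f), (fun n => xget i0 [set j | f j = n]); split => //.
- move=> m n /[!inE] -[i _ <-{m}] -[j _ <-{n}]; rewrite /= !eK => ->; exact: erefl.
- by move=> i _; exists (f i).
Qed.

Lemma esum_enum (i0 : I) : exists (D : set nat) (e : nat -> I),
  set_bij D [set: I] e /\ forall a : I -> \bar R, (forall i, 0 <= a i) ->
    \esum_(i in [set: I]) a i = \sum_(n <oo | n \in D) a (e n).
Proof.
have [D [e De]] := countable_enum i0; exists D, e; split => // a a0.
rewrite (@reindex_esum _ _ _ D setT e a De) nneseries_esum//; congr esum.
by apply/seteqP; split => n /=; rewrite inE.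
Qed.

Variables (d : measure_display) (T : measurableType d).
Variable mu : {measure set T -> \bar R}.

Lemma measure_bigcup_esum (F : I -> set T) : (forall i, measurable (F i)) ->
  trivIset setT F -> mu (\bigcup_i F i) = \esum_(i in [set: I]) mu (F i).
Proof.
move=> mF tF; have [i0|I0] := pselect (exists i : I, True); last first.
  have -> : [set: I] = set0 by apply/seteqP; split => // i _; case: I0; exists i.
  by rewrite bigcup_set0 measure0 esum_set0.
case: i0 => i0 _; have [D [e [De ->//]]] := esum_enum i0.
have [_ inje surje] := De.
rewrite -(measure_bigcup _ D (fun n => F (e n)))//.
- congr (mu _); apply/seteqP; split=> [x [i _ Fx]|x [n _ Fx]]; last by exists (e n).
  by have [n Dn en] := surje i Logic.I; exists n => //; rewrite en.
- move=> m n Dm Dn ne; apply: inje; rewrite ?inE//.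
  exact: tF ne.
Qed.

Lemma measurable_fun_esum (D : set T) (f : I -> T -> \bar R) : measurable D ->
  (forall i x, 0 <= f i x) -> (forall i, measurable_fun D (f i)) ->
  measurable_fun D (fun x => \esum_(i in [set: I]) f i x).
Proof.
move=> mD f0 mf; have [i0|I0] := pselect (exists i : I, True); last first.
  have -> : [set: I] = set0 by apply/seteqP; split => // i _; case: I0; exists i.
  by under eq_fun do rewrite esum_set0; exact: measurable_cst.
case: i0 => i0 _; have [P [e [_ E]]] := esum_enum i0.
under eq_fun do rewrite E//.
apply: ge0_emeasurable_sum => //.
Qed.

Lemma ge0_integral_esum (D : set T) (f : I -> T -> \bar R) : measurable D ->
  (forall i x, 0 <= f i x) -> (forall i, measurable_fun D (f i)) ->
  \int[mu]_(x in D) (\esum_(i in [set: I]) f i x) =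
  \esum_(i in [set: I]) \int[mu]_(x in D) f i x.
Proof.
move=> mD f0 mf; have [i0|I0] := pselect (exists i : I, True); last first.
  have -> : [set: I] = set0 by apply/seteqP; split => // i _; case: I0; exists i.
  by under eq_integral do rewrite esum_set0; rewrite esum_set0 integral0.
case: i0 => i0 _; have [P [e [_ E]]] := esum_enum i0.
rewrite E; last by move=> i; exact: integral_ge0.
under eq_integral do rewrite E//.
rewrite eseries_mkcond.
under eq_integral do rewrite eseries_mkcond.
rewrite integral_nneseries//.
- by apply: eq_eseriesr => n _; case: (n \in P); rewrite ?integral0.
- by move=> n; case: (n \in P) => //; exact: measurable_cst.
- by move=> n x _; case: (n \in P).
Qed.

End CountableSums.

(** * Cardinalities as sums of indicators *)

Section IndicatorSums.
Local Open Scope ereal_scope.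
Variables (R : realType) (I : choiceType).
Implicit Type A : set I.

Lemma esum_indic_ge A (B : {fset I}) : [set` B] `<=` A ->
  (#|` B|%:R)%:E <= \esum_(i in [set: I]) (\1_A i)%:E :> \bar R.
Proof.
move=> BA; apply: esum_ge; exists [set` B]; first by split.
rewrite fsbig_finite//= set_fsetK.
rewrite (eq_big_seq (fun=> 1%:E)); last first.
  by move=> i iB; rewrite indicE mem_set//; exact: BA.
by rewrite sumEFin lee_fin big_const_seq count_predT iter_addr_0.
Qed.

Lemma esum_indic_fset (B : {fset I}) :
  \esum_(i in [set: I]) (\1_[set` B] i)%:E = (#|` B|%:R)%:E :> \bar R.
Proof.
have -> : \esum_(i in [set: I]) (\1_[set` B] i)%:E =
    \esum_(i in [set: I]) if i \in [set` B] then 1%E else 0%E :> \bar R.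
  by apply: eq_esum => i _; rewrite indicE; case: (i \in _).
rewrite -esum_mkcond esum_fset// fsbig_finite//= set_fsetK.
by rewrite sumEFin big_const_seq count_predT iter_addr_0.
Qed.

Lemma esum_indic_lty A : \esum_(i in [set: I]) (\1_A i)%:E < +oo :> \bar R ->
  finite_set A.
Proof.
move=> Afin; apply: contrapT => /infinite_set_fset infA.
have fA : \esum_(i in [set: I]) (\1_A i)%:E \is a @fin_num R.
  by rewrite ge0_fin_numE// esum_ge0.
have [B BA cB] :=
  infA (Num.truncn (fine (\esum_(i in [set: I]) (\1_A i)%:E : \bar R))).+1.
have := @esum_indic_ge A B BA; rewrite -(fineK fA) lee_fin leNgt.
move=> /negP; apply.
apply: lt_le_trans (truncnS_gt _) _.
by rewrite ler_nat.
Qed.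

End IndicatorSums.

(** * Scaling and tails of summable families *)

Section SummableFamilies.
Local Open Scope ereal_scope.
Variables (R : realType) (I : choiceType).
Implicit Type a : I -> \bar R.

Lemma esum_mulr_le (r : R) a : (0 <= r)%R -> (forall i, 0 <= a i) ->
  \esum_(i in [set: I]) (r%:E * a i) <= r%:E * \esum_(i in [set: I]) a i.
Proof.
move=> r0 a0; apply: ge_ereal_sup => _ [F [Ffin _] <-].
rewrite -ge0_mule_fsumr//; apply: lee_wpmul2l; first by rewrite lee_fin.
by apply: ereal_sup_ubound; exists F.
Qed.

(** F is a finite set whose partial sum comes within e of the supremum; as the total is finite, the
    partial sum can be subtracted. *)
Lemma esum_tail a (e : R) : (forall i, 0 <= a i) ->
  \esum_(i in [set: I]) a i < +oo -> (0 < e)%R ->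
  exists F : {fset I}, \esum_(i in ~` [set` F]) a i <= e%:E.
Proof.
move=> a0 afin e0.
have fa : \esum_(i in [set: I]) a i \is a fin_num.
  by rewrite ge0_fin_numE// esum_ge0.
have [_ [F [Ffin _] <-] ltF] := ub_ereal_sup_adherent e0 fa.
have [F' FE] := finite_fsetP.1 Ffin; exists F'; rewrite -FE.
move: ltF; rewrite -/(esum _ _) [X in X - _ < _ -> _](esumID F)//.
rewrite setTI setTI -esum_fset//; last first.
have : \esum_(i in F) a i \is a fin_num.
  rewrite ge0_fin_numE ?esum_ge0//; apply: le_lt_trans afin.
  by rewrite [leRHS](esumID F)// setTI leeDl// esum_ge0.
case: (\esum_(i in F) a i) => // s _.
have : 0 <= \esum_(i in ~` F) a i by exact: esum_ge0.
case: (\esum_(i in ~` F) a i) => [t| |]//= t0.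
- by rewrite -!EFinD lte_fin lee_fin => st; lra.
Qed.

End SummableFamilies.

(** * Orbit counts *)

Section OrbitCount.
Variables (R : realType) (d : measure_display) (T : measurableType d).
Variable mu : {measure set T -> \bar R}.
Variables (G : groupType) (a : G -> T -> T).
Hypothesis cG : countable [set: G].
Hypothesis aP : is_group_action a.
Hypothesis a_mu : preserves_measure mu a.
Implicit Types (W D : set T) (x : T) (g h : G).

(** For W = [pullback A] below this is the set B_x of the proof idea; [orbit_count] is its
    cardinality, and for W = X it is the function N. *)
Definition hits W x : set G := [set g | W (a g x)].

Definition orbit_count W x : \bar R :=
  (\esum_(g in [set: G]) (\1_(hits W x) g)%:E)%E.

Lemma actM g h x : a (g * h)%g x = a g (a h x). Proof. by case: aP. Qed.

Lemma act1 x : a 1%g x = x. Proof. by case: aP. Qed.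

Lemma actVK g x : a g^-1%g (a g x) = x.
Proof. by rewrite -actM mulVg act1. Qed.

Lemma actKV g x : a g (a g^-1%g x) = x.
Proof. by rewrite -actM mulgV act1. Qed.

Lemma measurable_act g W : measurable W -> measurable (a g @^-1` W).
Proof. by move=> mW; rewrite -[X in measurable X]setTI; apply: (a_mu g).1. Qed.

Lemma measure_act g W : measurable W -> mu (a g @^-1` W) = mu W.
Proof. exact: (a_mu g).2. Qed.

Lemma indic_hits W x g : \1_(hits W x) g = \1_W (a g x) :> R.
Proof. by []. Qed.

Lemma orbit_count_act W g x : orbit_count W (a g x) = orbit_count W x.
Proof.
rewrite /orbit_count.
rewrite [RHS](@reindex_esum _ _ _ [set: G] setT (fun h => (h * g)%g)).
  by apply: eq_esum => h _; rewrite !indic_hits actM.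
split => //; first by move=> h k _ _; exact: mulIg.
by move=> h _; exists (h * g^-1)%g => //; rewrite mulgVK.
Qed.

Lemma orbit_count_ge0 W x : (0 <= orbit_count W x)%E.
Proof. by apply: esum_ge0. Qed.

Lemma orbit_count_le W W' x : (forall g, W (a g x) -> W' (a g x)) ->
  (orbit_count W x <= orbit_count W' x)%E.
Proof.
move=> WW'; apply: le_esum => g _; rewrite lee_fin !indic_hits !indicE ler_nat.
by have [/set_mem/WW' /mem_set->|] := boolP (a g x \in W).
Qed.

Lemma orbit_count_hits W x : (orbit_count W x < +oo)%E ->
  exists2 B : {fset G}, hits W x = [set` B] &
    orbit_count W x = (#|` B|%:R)%:E.
Proof.
move=> /esum_indic_lty /finite_fsetP[B hB]; exists B => //.
by rewrite /orbit_count hB esum_indic_fset.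
Qed.

Lemma measurable_orbit_count D W : measurable D -> measurable W ->
  measurable_fun D (orbit_count W).
Proof.
move=> mD mW; apply: measurable_fun_esum => // g.
apply/measurable_EFinP.
have -> : (fun x => \1_(hits W x) g) = \1_(a g @^-1` W) :> (T -> R).
  by [].
by apply: measurable_indic; exact: measurable_act.
Qed.

(* Existence and uniqueness hold at every point of [Om], which will be a conull
   invariant set, and freeness is built in: the group element is unique. *)
Definition strict_domain (Om Y : set T) : Prop :=
  [/\ measurable Y, Y `<=` Om, (forall x, Om x -> exists g, Y (a g x)) &
      (forall x g h, Y (a g x) -> Y (a h x) -> g = h)].

(** Unfolding: the translates g Y tile Om, so the sum over g of mu(Y [&] g^-1 W) = mu(g Y [&] W)
    adds up to mu W. *)
Lemma integral_orbit_count Om Y W : strict_domain Om Y ->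
  measurable W -> W `<=` Om ->
  (\int[mu]_(x in Y) (orbit_count W x) = mu W)%E.
Proof.
move=> [mY YOm Yex Yuniq] mW WOm.
have hE g : (fun x => (\1_(hits W x) g)%:E) =
    (fun x => (\1_(a g @^-1` W) x)%:E) :> (T -> \bar R).
  by [].
rewrite /orbit_count ge0_integral_esum//; last first.
  move=> g; rewrite hE; apply/measurable_EFinP/measurable_indic.
  exact: measurable_act.
transitivity (\esum_(g in [set: G]) mu (W `&` a g^-1%g @^-1` Y))%E.
  apply: eq_esum => g _; rewrite hE integral_indic//; last exact: measurable_act.
  rewrite -[LHS](measure_act g^-1%g); last first.
    by apply: measurableI => //; exact: measurable_act.
  by congr (mu _); apply/seteqP; split => x []; rewrite /= actKV.
rewrite -measure_bigcup_esum//.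
- congr (mu _); apply/seteqP; split => [x [g _ []]//|x Wx].
  have [g gx] := Yex _ (WOm _ Wx).
  by exists g^-1%g => //; split => //=; rewrite invgK.
- by move=> g; apply: measurableI => //; exact: measurable_act.
- move=> g h _ _ [x [[_ /= gx] [_ /= hx]]].
  by apply: invg_inj; exact: Yuniq gx hx.
Qed.

End OrbitCount.

(** * Transfer of almost invariant sets *)

Section StrictCoupling.
Variables (R : realType) (d : measure_display) (T : measurableType d).
Variable mu : {measure set T -> \bar R}.
Variables (G L : groupType) (aG : G -> T -> T) (aL : L -> T -> T).
Hypotheses (cG : countable [set: G]) (cL : countable [set: L]).
Hypotheses (aGP : is_group_action aG) (aLP : is_group_action aL).
Hypotheses (aG_mu : preserves_measure mu aG) (aL_mu : preserves_measure mu aL).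
Hypothesis aGL : forall g l x, aG g (aL l x) = aL l (aG g x).
Variables Om X Y : set T.
Hypothesis OmG : forall g x, Om x -> Om (aG g x).
Hypothesis OmL : forall l x, Om x -> Om (aL l x).
Hypotheses (YP : strict_domain aG Om Y) (XP : strict_domain aL Om X).
Hypothesis X_fin : (mu X < +oo)%E.
Implicit Types (A : {fset L}) (g : G) (l : L) (x : T).

Let mX : measurable X. Proof. by case: XP. Qed.
Let XOm : X `<=` Om. Proof. by case: XP. Qed.
Let Xuniq x l l' : X (aL l x) -> X (aL l' x) -> l = l'.
Proof. by case: XP => _ _ _; apply. Qed.
Let mY : measurable Y. Proof. by case: YP. Qed.

(* The measure of {x \in X | alpha(g,x) = l}. *)
Definition transition g l : \bar R := mu (X `&` [set x | X (aL l (aG g x))]).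

(** The set U of the proof idea. *)
Definition pullback A : set T := \bigcup_(l in [set` A]) (aL l @^-1` X).

Definition pullback_exit A g : set T :=
  pullback A `&` [set x | ~ pullback A (aG g x)].

Lemma measurable_pullback A : measurable (pullback A).
Proof.
apply: fin_bigcup_measurable => // l _.
exact: (measurable_act aL_mu).
Qed.

Lemma preimage_domain_sub l : aL l @^-1` X `<=` Om.
Proof. by move=> x /XOm /(OmL l^-1%g); rewrite (actVK aLP). Qed.

Lemma pullback_sub A : pullback A `<=` Om.
Proof. by move=> x [l _]; exact: preimage_domain_sub. Qed.

Lemma measurable_pullback_exit A g : measurable (pullback_exit A g).
Proof.
apply: measurableI; first exact: measurable_pullback.
have -> : [set x | ~ pullback A (aG g x)] = ~` (aG g @^-1` pullback A) by [].
apply/measurableC/(measurable_act aG_mu).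
exact: measurable_pullback.
Qed.

Lemma measure_pullback A : mu (pullback A) = ((#|` A|%:R)%:E * mu X)%E.
Proof.
rewrite /pullback measure_fin_bigcup//; last 2 first.
- by move=> l k _ _ [x [lx kx]]; exact: Xuniq lx kx.
- by move=> l _; exact: (measurable_act aL_mu).
rewrite fsbig_finite//= set_fsetK.
rewrite (eq_bigr (fun=> mu X)); last by move=> l _; rewrite (aL_mu l).2.
have mu_fin : mu X \is a fin_num by rewrite ge0_fin_numE.
by rewrite -(fineK mu_fin) sumEFin big_const_seq count_predT iter_addr_0
  -EFinM mulr_natl.
Qed.

(** If y = k x is in X with k in A, and l = alpha(g, y), then (l k) g x = l g y is in X. So g x
    leaves U only if l k is outside A, and for fixed l this happens for exactly |[exits A l]|
    elements k of A. *)
Lemma measure_pullback_exit A g :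
  (mu (pullback_exit A g) <=
   \esum_(l in [set: L]) ((#|` exits A l|%:R)%:E * transition g l))%E.
Proof.
(* The part of X on which alpha(g, .) = l and l carries k out of A; for fixed k these sets are
   disjoint in l. *)
pose F k l := X `&` [set x | (l * k)%g \notin A /\ X (aL l (aG g x))].
have mF k l : measurable (F k l).
  have [lkA|lkA] := boolP ((l * k)%g \in A).
    rewrite (_ : F k l = set0)//; apply/seteqP; split => // x [_ []].
    by rewrite lkA.
  rewrite (_ : F k l = X `&` aG g @^-1` (aL l @^-1` X)).
    apply: measurableI => //; apply: (measurable_act aG_mu).
    exact: (measurable_act aL_mu).
  by apply/seteqP; split => [x [Xx []]|x [Xx lx]].
have exitE : pullback_exit A g `<=`
    \bigcup_(k in [set` A]) (aL k @^-1` (\bigcup_l F k l)).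
  move=> x [[k kA kx] nx]; exists k => //=.
  have Omy : Om (aG g (aL k x)) by apply/OmG/XOm.
  have [_ _ Xex _] := XP; have [l lX] := Xex _ Omy.
  exists l => //; split => //=; split => //; apply/negP => lkA; apply: nx.
  by exists (l * k)%g => //=; rewrite (actM aLP) -aGL.
have mUF k : measurable (\bigcup_l F k l).
  exact: countable_bigcupT_measurable.
have mPF k : measurable (aL k @^-1` (\bigcup_l F k l)).
  exact: (measurable_act aL_mu).
apply: le_trans (le_measure mu _ _ exitE) _.
- by rewrite inE; exact: measurable_pullback_exit.
- by rewrite inE; exact: fin_bigcup_measurable.
have H1 : (mu (\bigcup_(k in [set` A]) (aL k @^-1` (\bigcup_l F k l))) <=
    \sum_(k <- A) mu (\bigcup_l F k l))%E.
  rewrite bigcup_fset.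
  elim: (enum_fset A) => [|k r IH]; first by rewrite !big_nil measure0.
  rewrite !big_cons; apply: le_trans (measureU2 _ _ _) _ => //.
    by apply: bigsetU_measurable => *.
  apply: leeD => //.
  by have /eqP := measure_act aL_mu k (mUF k); rewrite eq_le => /andP[].
apply: le_trans H1 _.
have H2 k : mu (\bigcup_l F k l) =
    (\esum_(l in [set: L]) (((l * k)%g \notin A)%:R%:E * transition g l))%E.
  rewrite measure_bigcup_esum//.
    apply: eq_esum => l _; rewrite /transition /F.
    have [lkA|lkA] := boolP ((l * k)%g \in A).
      rewrite mul0e (_ : X `&` _ = set0) ?measure0//.
      by apply/seteqP; split => // x [_ [/negP]].
    by rewrite mul1e; congr (mu _); apply/seteqP; split => [x [Xx []]|x [Xx lx]].
  by move=> l l' _ _ [x [[_ [_ lx]] [_ [_ lx']]]]; exact: Xuniq lx lx'.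
rewrite (eq_bigr _ (fun k _ => H2 k)) -esum_sum//; last first.
  by move=> l k _ _; rewrite mule_ge0.
apply: le_esum => l _.
rewrite -ge0_sume_distrl; last by move=> k _; rewrite lee_fin.
rewrite lee_wpmul2r//= sumEFin lee_fin -natr_sum ler_nat.
have -> : (\sum_(k <- A) ((l * k)%g \notin A) =
    size [seq k <- A | (l * k)%g \notin A])%N.
  by rewrite size_filter -sumn_count sumnE big_map.
apply: uniq_leq_size; first by rewrite filter_uniq.
by move=> k; rewrite mem_filter !inE andbC.
Qed.

(* The part of X over which the orbit count exceeds m: removing it truncates the
   count at m, which is what makes uniform integrability usable. *)
Definition excess (m : nat) : set T :=
  X `&` [set x | (m%:R%:E < orbit_count R aG X x)%E].

Lemma measurable_excess m : measurable (excess m).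
Proof.
apply: measurableI => //.
have mf := measurable_orbit_count cG aG_mu measurableT mX.
have -> : [set x | (m%:R%:E < orbit_count R aG X x)%E] =
    setT `&` orbit_count R aG X @^-1` `]m%:R%:E, +oo[%classic.
  by apply/seteqP; split => [x|x [_]] /=; rewrite in_itv/= andbT.
by apply: mf => //; exact: emeasurable_itv.
Qed.

(** The count is constant along orbits, so an orbit meeting X more than m times has all its points
    of X in [excess m]. *)
Lemma orbit_count_excess m x :
  (orbit_count R aG X x <= m%:R%:E + orbit_count R aG (excess m) x)%E.
Proof.
have [mlt|le] := ltP (m%:R%:E : \bar R) (orbit_count R aG X x); last first.
  by apply: le_trans le _; rewrite leeDl// orbit_count_ge0.
apply: (@le_trans _ _ (orbit_count R aG (excess m) x)).
  by apply: orbit_count_le => g gx; split => //=; rewrite orbit_count_act.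
by rewrite leeDr.
Qed.

Lemma orbit_count_fin_ae W : measurable W -> W `<=` Om -> (mu W < +oo)%E ->
  {ae mu, forall x, Y x -> (orbit_count R aG W x < +oo)%E}.
Proof.
move=> mW WOm Wfin.
have int_W : mu.-integrable Y (orbit_count R aG W).
  apply/integrableP; split; first exact: measurable_orbit_count.
  under eq_integral do rewrite gee0_abs ?orbit_count_ge0//.
  by rewrite (integral_orbit_count cG aGP aG_mu YP).
apply: filterS (integrable_ae mY int_W) => x /[apply].
by rewrite ge0_fin_numE// orbit_count_ge0.
Qed.

(** By unfolding, the measure is the integral over Y of the visits to this set. An orbit visiting it
    has infinite count, which is excluded for almost every x in Y because the count is integrable
    there. *)
Lemma measure_excess_oo :
  mu (X `&` [set x | orbit_count R aG X x = +oo%E]) = 0.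
Proof.
set W := X `&` _.
have mW : measurable W.
  apply: measurableI => //.
  have mf := measurable_orbit_count cG aG_mu measurableT mX.
  have -> : [set x | orbit_count R aG X x = +oo%E] =
    setT `&` orbit_count R aG X @^-1` [set +oo%E] by rewrite setTI.
  by apply: mf => //; exact: emeasurable_set1.
rewrite -(integral_orbit_count cG aGP aG_mu YP mW); last by move=> x [/XOm].
rewrite -[RHS](integral0 mu Y); apply: ge0_ae_eq_integral => //.
- exact: measurable_orbit_count.
- by move=> x _; exact: orbit_count_ge0.
apply: filterS (orbit_count_fin_ae mX XOm X_fin) => x Xfin /Xfin {}Xfin.
rewrite /orbit_count esum1// => g _; rewrite indicE memNset// => -[_] /=.
by rewrite orbit_count_act// => E; rewrite E ltxx in Xfin.
Qed.

(** Continuity from above: the sets [excess m] decrease, inside X of finite measure, to the null set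
    of infinite counts. *)
Lemma excess_small (e : R) : 0 < e -> exists m, (mu (excess m) <= e%:E)%E.
Proof.
move=> e0; apply: contrapT => /forallNP large.
have capE : \bigcap_m excess m =
    X `&` [set x | orbit_count R aG X x = +oo%E].
  apply/seteqP; split => [x cap|x [Xx /= xoo] m _]; last first.
    by split => //=; rewrite xoo ltry.
  split; first by have [] := cap 0%N.
  rewrite /=; apply/eqP; apply: contrapT => /negP; rewrite -ltey => xfin.
  have xf : orbit_count R aG X x \is a fin_num.
    by rewrite ge0_fin_numE// orbit_count_ge0.
  (* A finite count is less than its truncation plus one, so x is not in [excess] at that index. *)
  have [_ /=] := cap (Num.truncn (fine (orbit_count R aG X x))).+1 I.
  rewrite -(fineK xf) lte_fin fineK//=; apply/negP; rewrite -leNgt.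
  exact/ltW/truncnS_gt.
have mcap : measurable (\bigcap_m excess m).
  by apply: bigcapT_measurable; exact: measurable_excess.
have cvg0 : mu \o excess @ \oo --> mu (\bigcap_m excess m).
  apply: nonincreasing_cvg_mu => //.
  - by apply: le_lt_trans X_fin; apply: le_measure;
      rewrite ?inE//; [exact: measurable_excess|move=> x []].
  - exact: measurable_excess.
  - move=> m n mn; apply/subsetPset => x [Xx /= nx]; split => //=.
    by apply: le_lt_trans nx; rewrite lee_fin ler_nat.
have : (e%:E <= limn (mu \o excess))%E.
  apply: lime_ge; first by apply/cvg_ex; eexists; exact: cvg0.
  by apply: nearW => m /=; apply/ltW; rewrite ltNge; apply/negP/large.
rewrite (cvg_lim _ cvg0)// capE measure_excess_oo lee_fin leNgt e0.
by [].
Qed.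

Lemma orbit_count_pullback A x : (orbit_count R aG (pullback A) x <=
  \sum_(l <- A) orbit_count R aG X (aL l x))%E.
Proof.
rewrite /orbit_count -esum_sum//; apply: le_esum => g _.
rewrite sumEFin lee_fin indic_hits indicE.
case: (boolP (_ \in _)) => [|_]; last by rewrite sumr_ge0.
move=> /set_mem [l /= lA lgx].
rewrite (big_fsetD1 l)//= indic_hits indicE mem_set ?lerDl ?sumr_ge0//.
by rewrite aGL.
Qed.

Lemma pullback_hits A x : (orbit_count R aG (pullback A) x < +oo)%E ->
  exists B : {fset G},
    orbit_count R aG (pullback A) x = (#|` B|%:R)%:E /\
    forall g, orbit_count R aG (pullback_exit A g) x = (#|` exits B g|%:R)%:E.
Proof.
move=> /orbit_count_hits[B hB cB]; exists B; split => // g.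
rewrite -esum_indic_fset; congr esum; apply/funext => h.
suff -> : hits aG (pullback_exit A g) x = [set` exits B g] by [].
have BE k : pullback A (aG k x) <-> k \in B.
  by rewrite -[X in X <-> _]/(hits aG (pullback A) x k) hB.
apply/seteqP; split => k.
  move=> [/BE kB /= nk]; rewrite /= !inE kB/=; apply/negP => /BE.
  by rewrite (actM aGP).
rewrite /= !inE => /andP[kB /negP nk]; split; first exact/BE.
by move=> /=; rewrite -(actM aGP) => /BE.
Qed.

(** By contradiction: if no B works, almost every B_x with x in Y is empty, has too many exits, or
    has more than 2 m |A| points. In each case |B_x| is at most [f x] below, and integrating over Y
    contradicts the assumed inequality. *)
Lemma folner_transfer A (m : nat) (D : R) (r : seq G) : 0 <= D ->
  (D%:E * (\sum_(g <- r)
     \esum_(l in [set: L]) ((#|` exits A l|%:R)%:E * transition g l))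
   + (2 * #|` A|%:R)%:E * mu (excess m) < (#|` A|%:R)%:E * mu X)%E ->
  exists B : {fset G}, [/\ B != fset0, (#|` B| <= 2 * m * #|` A|)%N &
    D * \sum_(g <- r) #|` exits B g|%:R <= #|` B|%:R].
Proof.
move=> D0; rewrite ltNge => /negP bound; apply: contrapT => /forallNP noB.
apply: bound; rewrite -measure_pullback.
have mU := measurable_pullback A.
have mW g := measurable_pullback_exit A g.
have mV l : measurable (aL l @^-1` excess m).
  by apply: (measurable_act aL_mu); exact: measurable_excess.
pose f x := (D%:E * (\sum_(g <- r) orbit_count R aG (pullback_exit A g) x)
   + 2%:R%:E * \sum_(l <- A) orbit_count R aG (aL l @^-1` excess m) x)%E.
have Ufin : (mu (pullback A) < +oo)%E.
  by rewrite measure_pullback lte_mul_pinfty// lee_fin.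
have le_f : {ae mu, forall x, Y x -> (orbit_count R aG (pullback A) x <= f x)%E}.
  apply: filterS (orbit_count_fin_ae mU (@pullback_sub A) Ufin) => x /[apply] xfin.
  have [B [BE exE]] := pullback_hits xfin.
  have f1 : (0 <= D%:E * (\sum_(g <- r) orbit_count R aG (pullback_exit A g) x))%E.
    by rewrite mule_ge0 ?lee_fin ?sume_ge0// => g _; exact: orbit_count_ge0.
  have f2 : (0 <= 2%:R%:E * \sum_(l <- A) orbit_count R aG (aL l @^-1` excess m) x)%E.
    by rewrite mule_ge0 ?lee_fin ?sume_ge0// => g _; exact: orbit_count_ge0.
  have [B0|B0] := eqVneq B fset0.
    by rewrite BE B0 cardfs0 adde_ge0.
  have [Dle|Dlt] := leP (D * \sum_(g <- r) #|` exits B g|%:R) #|` B|%:R; last first.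
    apply: (@le_trans _ _ (D%:E *
        (\sum_(g <- r) orbit_count R aG (pullback_exit A g) x))%E).
      under eq_bigr do rewrite exE.
      by rewrite BE sumEFin -EFinM lee_fin ltW.
    by rewrite leeDl.
  have large : (2 * m * #|` A| < #|` B|)%N.
    by rewrite ltnNge; apply/negP => le; apply: (noB B).
  apply: (@le_trans _ _ (2%:R%:E *
      \sum_(l <- A) orbit_count R aG (aL l @^-1` excess m) x)%E);
    last by rewrite leeDr.
  set s := (\sum_(l <- A) _)%E.
  have : (orbit_count R aG (pullback A) x <= (m%:R * #|` A|%:R)%:E + s)%E.
    apply: le_trans (orbit_count_pullback _ _) _.
    have -> : ((m%:R * #|` A|%:R)%:E = \sum_(l <- A) (m%:R)%:E :> \bar R)%E.
      by rewrite sumEFin big_const_seq count_predT iter_addr_0 mulr_natr.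
    rewrite /s -big_split/=; apply: lee_sum => l _.
    apply: le_trans (orbit_count_excess m _) _; rewrite leeD2l//.
    by apply: le_esum => g _; rewrite !indic_hits !indicE aGL.
  have : (0 <= s)%E by apply: sume_ge0 => l _; exact: orbit_count_ge0.
  rewrite BE; case: s => [s| |]; last by [].
  2: by move=> _ _; rewrite gt0_muley ?lte_fin// leey.
  rewrite -!EFinM -EFinD !lee_fin => s0.
  (* Here m |A| is less than half of |B|, so |B| <= m |A| + s forces |B| <= 2 s; this is the source
     of both factors 2. *)
  have : (2 * (m%:R * #|` A|%:R) < #|` B|%:R :> R).
    by rewrite -!natrM ltr_nat mulnA.
  lra.
(* The pointwise bound is integrated over Y, and unfolding turns each count back into a measure. *)
rewrite -(integral_orbit_count cG aGP aG_mu YP mU (@pullback_sub A)).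
have mc W : measurable W -> measurable_fun Y (orbit_count R aG W).
  exact: measurable_orbit_count.
have c0 W x : (0 <= orbit_count R aG W x)%E by exact: orbit_count_ge0.
have ms1 : measurable_fun Y
    (fun x => \sum_(g <- r) orbit_count R aG (pullback_exit A g) x)%E.
  by apply: emeasurable_sum => g; exact: mc.
have ms2 : measurable_fun Y
    (fun x => \sum_(l <- A) orbit_count R aG (aL l @^-1` excess m) x)%E.
  by apply: emeasurable_sum => g; exact: mc.
have mf1 : measurable_fun Y
    (fun x => D%:E * (\sum_(g <- r) orbit_count R aG (pullback_exit A g) x))%E.
  exact: measurable_funeM.
have mf2 : measurable_fun Y
    (fun x => 2%:R%:E * \sum_(l <- A) orbit_count R aG (aL l @^-1` excess m) x)%E.
  exact: measurable_funeM.
apply: (@le_trans _ _ (\int[mu]_(x in Y) (f x)))%E.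
  apply: ae_ge0_le_integral => //; first exact: mc.
  - by move=> x _; rewrite adde_ge0// mule_ge0 ?lee_fin ?sume_ge0.
  - exact: emeasurable_funD.
rewrite ge0_integralD//; last 2 first.
- by move=> x _; rewrite mule_ge0 ?lee_fin ?sume_ge0.
- by move=> x _; rewrite mule_ge0 ?lee_fin ?sume_ge0.
rewrite !ge0_integralZl//; last 2 first.
- by move=> x _; rewrite sume_ge0.
- by move=> x _; rewrite sume_ge0.
rewrite !ge0_integral_sum//; try by move=> *; exact: mc.
rewrite leeD//.
  rewrite lee_wpmul2l ?lee_fin//; apply: lee_sum => g _.
  rewrite (integral_orbit_count cG aGP aG_mu YP)//; last first.
    by move=> x [/pullback_sub].
  exact: measure_pullback_exit.
rewrite EFinM -muleA lee_wpmul2l ?lee_fin//.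
rewrite (eq_bigr (fun=> mu (excess m))); last first.
  move=> l _; rewrite (integral_orbit_count cG aGP aG_mu YP)//.
    by rewrite (measure_act aL_mu)//; exact: measurable_excess.
  by move=> x [] /preimage_domain_sub.
have V_fin : mu (excess m) \is a fin_num.
  rewrite ge0_fin_numE//; apply: le_lt_trans X_fin.
  by apply: le_measure; rewrite ?inE//; [exact: measurable_excess|move=> x []].
by rewrite -(fineK V_fin) sumEFin big_const_seq count_predT iter_addr_0
  -EFinM mulr_natl.
Qed.

End StrictCoupling.

(** * From couplings to strict couplings *)

(* Unlike the library's [ge0_le_integral], no measurability is assumed. *)
Lemma ge0_le_lower_integral (R : realType) d (T : measurableType d)
    (mu : {measure set T -> \bar R}) (D : set T) (f g : T -> \bar R) :
  (forall x, D x -> 0 <= f x <= g x)%E ->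
  (\int[mu]_(x in D) f x <= \int[mu]_(x in D) g x)%E.
Proof.
move=> fg; rewrite !ge0_integralE; last 2 first.
- by move=> x /fg /andP[f0]; exact: le_trans.
- by move=> x /fg /andP[].
apply: ereal_sup_le => _ [h hf <-]; exists h => //= x.
apply: le_trans (hf x) _; rewrite /patch; case: ifPn => // /set_mem /fg.
by case/andP.
Qed.

Lemma negligible_countable_bigcup (R : realType) d (T : measurableType d)
    (mu : {measure set T -> \bar R}) (I : choiceType) (F : I -> set T) :
  countable [set: I] -> (forall i, mu.-negligible (F i)) ->
  mu.-negligible (\bigcup_i F i).
Proof.
move=> cI F0; have [[i0 _]|I0] := pselect (exists i : I, True); last first.
  rewrite (_ : \bigcup_i F i = set0); first exact: negligible_set0.
  by apply/seteqP; split => // x [i]; case: I0; exists i.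
have [D [e [_ _ surje]]] := countable_enum cI i0.
apply: (negligibleS _ (negligible_bigcup (fun n => F0 (e n)))) => x [i _ Fx].
by have [n _ en] := surje i Logic.I; exists n => //; rewrite en.
Qed.

Section CouplingToStrict.
Variables (R : realType) (G L : groupType) (c : me_coupling R G L).
Hypotheses (cG : countable [set: G]) (cL : countable [set: L]).
Let mu := me_measure c.
Let aG := me_actG c.
Let aL := me_actL c.

(** Two visits of an orbit to D are the same point, by uniqueness of the representative, and then
    the same group element, by freeness. *)
Lemma strict_domainI (H : groupType) (a : H -> me_space c -> me_space c)
    (D Om : set (me_space c)) :
  is_group_action a -> measurable D -> measurable Om ->
  (forall h x, Om x -> Om (a h x)) ->
  (forall x, Om x -> forall h, a h x = x -> h = 1%g) ->
  (forall x, Om x -> exists! y, (orbit_of a x `&` D) y) ->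
  strict_domain a Om (D `&` Om).
Proof.
move=> aP mD mOm OmH free fund; split.
- exact: measurableI.
- by move=> x [].
- move=> x Omx; have [y [[[h _ <-] Dy] _]] := fund x Omx.
  by exists h; split => //; exact: OmH.
- move=> x g h [Dg Og] [Dh Oh].
  have Omx : Om x by rewrite -(actVK aP g x); exact: OmH.
  have [y [_ yuniq]] := fund x Omx.
  have ghx : a g x = a h x.
    transitivity y; first by apply/esym/yuniq; split => //; exists g.
    by apply: yuniq; split => //; exists h.
  apply/(mulgI h^-1%g); rewrite mulVg; apply: (free x Omx).
  by rewrite (actM aP) ghx (actVK aP).
Qed.

Lemma strict_coupling : exists Om : set (me_space c),
  [/\ measurable Om, mu (~` Om) = 0,
      forall g x, Om x -> Om (aG g x), forall l x, Om x -> Om (aL l x) &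
   [/\ strict_domain aG Om (me_domG c `&` Om),
      strict_domain aL Om (me_domL c `&` Om),
      forall x, Om x -> forall l, aL l x = x -> l = 1%g &
      forall x, Om x -> exists! y, (orbit_of aL x `&` me_domL c) y]].
Proof.
have aGP : is_group_action aG := me_actGP c.
have aLP : is_group_action aL := me_actLP c.
have aG_mu : preserves_measure mu aG := me_preservesG c.
have aL_mu : preserves_measure mu aL := me_preservesL c.
have comm g l x : aG g (aL l x) = aL l (aG g x) := me_commute g l x.
have [mdG aeG] := me_domGP c; have [mdL aeL] := me_domLP c.
have := filterI (filterI (me_freeG c) (me_freeL c)) (filterI aeG aeL).
move=> [N [mN N0 goodN]].
have good x : ~ N x -> ((forall g, aG g x = x -> g = 1%g) /\
   (forall l, aL l x = x -> l = 1%g)) /\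
   (exists! y, (orbit_of aG x `&` me_domG c) y) /\
   (exists! y, (orbit_of aL x `&` me_domL c) y).
  by move=> nx; apply: contrapT => /goodN.
(* Saturating the exceptional null set under both groups makes its complement invariant;
   countability keeps it null. *)
pose bad := \bigcup_g \bigcup_l (aL l @^-1` (aG g @^-1` N)).
have mbad : measurable bad.
  apply: countable_bigcupT_measurable => // g.
  apply: countable_bigcupT_measurable => // l.
  by apply: (measurable_act aL_mu); exact: (measurable_act aG_mu).
exists (~` bad).
have nN x : (~` bad) x -> ~ N x.
  by move=> nb Nx; apply: nb; exists 1%g => //; exists 1%g => //=;
    rewrite (act1 aLP) (act1 aGP).
have invG g x : (~` bad) x -> (~` bad) (aG g x).
  move=> nb [h _ [l _ /= hlx]]; apply: nb; exists (h * g)%g => //; exists l => //=.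
  by rewrite (actM aGP) comm.
have invL l x : (~` bad) x -> (~` bad) (aL l x).
  move=> nb [h _ [k _ /= hlx]]; apply: nb; exists h => //; exists (k * l)%g => //=.
  by rewrite (actM aLP).
have mOm := measurableC mbad.
split => //.
  rewrite setCK; apply: measure_negligible => //.
  apply: negligible_countable_bigcup => // g.
  apply: negligible_countable_bigcup => // l.
  have mgN : measurable (aG g @^-1` N) by exact: (measurable_act aG_mu).
  apply/negligibleP; first exact: (measurable_act aL_mu).
  by rewrite -[RHS]N0 -(measure_act aG_mu g mN) -(measure_act aL_mu l mgN).
split.
- apply: strict_domainI => // x /nN /good [[]]//.
  by move=> _ _ [].
- apply: strict_domainI => // x /nN /good [[]]//.
  by move=> _ _ [].
- by move=> x /nN /good [[]].
- by move=> x /nN /good [_ []].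
Qed.

Variable Om : set (me_space c).
Hypothesis mOm : measurable Om.
Hypothesis OmG : forall g x, Om x -> Om (aG g x).
Hypothesis OmL : forall l x, Om x -> Om (aL l x).
Hypothesis freeL : forall x, Om x -> forall l, aL l x = x -> l = 1%g.
Hypothesis fundL : forall x, Om x -> exists! y, (orbit_of aL x `&` me_domL c) y.
Let X := me_domL c `&` Om.

(** On Om neither [xget] takes its default: the orbit meets the domain in one point, and freeness
    leaves only one l leading there. *)
Lemma cocycle_strict g l x : X x -> X (aL l (aG g x)) ->
  cocycle g x = l.
Proof.
have aLP : is_group_action aL := me_actLP c.
move=> [Dx Ox] [Dl Ol].
have Og := OmG g Ox; have [y [yin yuniq]] := fundL Og.
have ly : aL l (aG g x) = y.
  by apply/esym/yuniq; split => //; exists l.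
have iE : induced_act g x = y.
  rewrite /induced_act; case: xgetP => [z _ zE|/(_ y)].
    by apply/esym/yuniq; rewrite -/aL -/aG -zE.
  case; apply/seteqP; split => [_ ->//|z zin].
  by rewrite (yuniq z zin).
have uniql : unique (fun l' => me_actL c l' (me_actG c g x) = induced_act g x) l.
  split; first by rewrite iE.
  move=> l'; rewrite iE -ly => lE; have E : aL l' (aG g x) = aL l (aG g x) by [].
  apply/esym/(mulgI l^-1%g); rewrite mulVg; apply: (freeL Og).
  by rewrite (actM aLP) E (actVK aLP).
rewrite /cocycle; case: xgetP => [z _ zE|/(_ l)//].
by apply: zE.2; rewrite iE -ly.
Qed.

(** The sets on which alpha(g, .) = l are disjoint, so each finite partial sum is the integral of a
    function below w(alpha(g, x)). Comparing lower integrals spares the measurability of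
    [cocycle]. *)
Lemma transition_esum_le (w : L -> R) g : (forall l, 0 <= w l) ->
  (\esum_(l in [set: L]) ((w l)%:E * transition mu aG aL X g l) <=
   \int[mu]_(x in me_domL c) (w (cocycle g x))%:E)%E.
Proof.
move=> w0; have mdL : measurable (me_domL c) by case: (me_domLP c).
have aG_mu : preserves_measure mu aG := me_preservesG c.
have aL_mu : preserves_measure mu aL := me_preservesL c.
have aLP : is_group_action aL := me_actLP c.
have mX : measurable X by exact: measurableI.
have [_ _ _ Xuniq] : strict_domain aL Om X by exact: strict_domainI.
apply: ge_ereal_sup => _ [F [Ffin _] <-].
pose E l := X `&` [set x | X (aL l (aG g x))].
have mE l : measurable (E l).
  apply: measurableI => //.
  exact: (measurable_act aG_mu g (measurable_act aL_mu l mX)).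
have -> : (\sum_(l \in F) ((w l)%:E * transition mu aG aL X g l) =
    \int[mu]_(x in me_domL c) \sum_(l \in F) ((w l)%:E * (\1_(E l) x)%:E))%E.
  rewrite ge0_integral_fsum//.
  - apply: eq_fsbigr => l _; rewrite ge0_integralZl//; last 1 first.
    + by rewrite lee_fin.
    + rewrite integral_indic// /transition; congr (_ * mu _)%E.
      by apply/seteqP; split => [x [[]]//|x []].
    + by apply/measurable_EFinP/measurable_indic.
  - by move=> l; apply: measurable_funeM; apply/measurable_EFinP/measurable_indic.
  - by move=> l x _; rewrite mule_ge0 ?lee_fin.
apply: ge0_le_lower_integral => x Dx.
rewrite fsume_ge0 /=; last by move=> l _; rewrite mule_ge0 ?lee_fin.
have [[l [lF [Xx lx]]]|none] := pselect (exists l, F l /\ E l x); last first.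
  rewrite fsbig1 ?lee_fin// => l lF; rewrite indicE memNset ?mule0//.
  by move=> lE; apply: none; exists l.
rewrite (cocycle_strict Xx lx) (fsbigD1 l)//= fsbig1.
  by rewrite adde0 indicE mem_set// mule1.
move=> k [_ kl]; rewrite indicE memNset ?mule0// => -[_ kx].
by apply: kl; exact: Xuniq kx lx.
Qed.

End CouplingToStrict.

(** * Choice of the scale *)

Section ExitScaling.
Variables (R : realType) (L : groupType) (S : {fset L}).
Hypothesis hS : finite_symmetric_generating S.
Variable phi : R -> R.
Hypothesis phi_pos : forall t : R, 0 < t -> 0 < phi t.
Hypothesis phi0_ge0 : 0 <= phi 0.
Hypothesis phi_nondecr : forall s t : R, 0 < s -> s <= t -> phi s <= phi t.
Hypothesis ratio_nondecr :
  forall s t : R, 0 < s -> s <= t -> s / phi s <= t / phi t.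

Let w (c : R) (l : L) : R := phi ((word_length S l)%:R / c).

Lemma phi_word_ge0 (c : R) l : 0 < c -> 0 <= w c l.
Proof.
rewrite /w; case: (word_length S l) => [|m] c0; first by rewrite mul0r.
by apply/ltW/phi_pos; rewrite divr_gt0.
Qed.

(** These are the sets over which [folner S k] takes its infimum. *)
Definition almost_invariant (k : R) (A : {fset L}) : Prop :=
  A != fset0 /\ #|` boundary S A|%:R / #|` A|%:R <= 1 / k.

(** With t = |l| / c <= n, the exits number at most |l| |boundary A| <= c t |A| / (C n), and
    monotonicity of t / phi(t) gives t / n <= phi(t) / phi(n). *)
Lemma exits_near (c C n : R) A l : 0 < c -> 0 < C -> 0 < n ->
  almost_invariant (C * n) A -> (word_length S l)%:R / c <= n ->
  #|` exits A l|%:R <= #|` A|%:R / phi n * (c / C) * w c l.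
Proof.
move=> c0 C0 n0 [A0 Ainv] ln.
have a0 : (0 : R) < #|` A|%:R by rewrite ltr0n cardfs_gt0.
have N0 := phi_pos n0.
have Xle : #|` exits A l|%:R <= (word_length S l)%:R * #|` boundary S A|%:R :> R.
  by rewrite -natrM ler_nat card_exits_word_length.
(* The ratio hypothesis needs t > 0; for length 0 there are no exits. *)
have [m0|m0] := eqVneq (word_length S l) 0%N.
  rewrite m0 mul0r in Xle; apply: le_trans Xle _.
  rewrite mulr_ge0 ?phi_word_ge0// mulr_ge0// divr_ge0// ltW//.
have t0 : (0 : R) < (word_length S l)%:R / c by rewrite divr_gt0// ltr0n lt0n.
have := ratio_nondecr t0 ln; rewrite -/(w c l).
rewrite ler_pdivrMr ?phi_pos// mulrAC ler_pdivlMr// => tN.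
apply: le_trans Xle _.
rewrite ler_pdivrMr// div1r in Ainv.
apply: le_trans (ler_wpM2l _ Ainv) _ => //.
have -> : (word_length S l)%:R * ((C * n)^-1 * #|` A|%:R) =
    (#|` A|%:R / phi n * (c / C)) * ((word_length S l)%:R / c * phi n / n).
  by field; rewrite !gt_eqF.
apply: ler_wpM2l; first by rewrite mulr_ge0// divr_ge0// ltW.
by rewrite ler_pdivrMr// [leRHS]mulrC.
Qed.

Lemma exits_far (c n : R) A l : 0 < n -> n <= (word_length S l)%:R / c ->
  #|` exits A l|%:R <= #|` A|%:R / phi n * w c l.
Proof.
move=> n0 ln; have N0 := phi_pos n0.
apply: (@le_trans _ _ #|` A|%:R); first by rewrite ler_nat card_exits_le.
rewrite mulrAC ler_pdivlMr// ler_wpM2l//.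
exact: phi_nondecr.
Qed.

(** Near l contribute at most |A| c J / C, small once C is large; far l contribute at most |A| times
    a tail of the sum J, small once n is large. C is fixed before n, as the comparison of Foelner
    functions requires. *)
Lemma exits_scale (p : L -> \bar R) (c e : R) : (forall l, 0 <= p l)%E ->
  0 < c -> (\esum_(l in [set: L]) ((w c l)%:E * p l) < +oo)%E -> 0 < e ->
  exists2 C0 : R, 0 < C0 & forall C : R, C0 <= C -> exists2 n0 : R, 0 <= n0 &
  forall (n : R) A, n0 < n -> almost_invariant (C * n) A ->
  ((phi n)%:E * (\esum_(l in [set: L]) ((#|` exits A l|%:R)%:E * p l)) <=
   (e * #|` A|%:R)%:E)%E.
Proof.
move=> p0 c0 Ifin e0.
have a0 l : (0 <= (w c l)%:E * p l)%E.
  by rewrite mule_ge0// lee_fin phi_word_ge0.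
have [J J0 IJ] : exists2 J : R, 0 <= J &
    (\esum_(l in [set: L]) ((w c l)%:E * p l) = J%:E)%E.
  have : (0 <= \esum_(l in [set: L]) ((w c l)%:E * p l))%E by exact: esum_ge0.
  by move: Ifin; case: esum => // J _ J0; exists J.
have [F Ftail] := esum_tail a0 Ifin (divr_gt0 e0 (ltr0Sn R 1)).
(* From this value on, c J / C <= e / 2; the summand 1 keeps it positive when J = 0. *)
have C0_gt0 : 0 < c * J * 2 / e + 1.
  rewrite ltr_wpDl//; apply: divr_ge0; last exact: ltW.
  by do 2 (apply: mulr_ge0 => //); exact: ltW.
exists (c * J * 2 / e + 1) => // C C0C.
have C_gt0 : 0 < C by exact: lt_le_trans C0C.
have t_ge0 l : 0 <= (word_length S l)%:R / c by rewrite divr_ge0// ltW.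
(* The sum bounds every |l| / c with l in F, so all far l lie outside F. *)
exists (\sum_(l <- F) (word_length S l)%:R / c); first exact: sumr_ge0.
move=> n A n0n Ainv.
have n_gt0 : 0 < n by apply: le_lt_trans n0n; exact: sumr_ge0.
have N0 := phi_pos n_gt0.
have Fn l : l \in F -> (word_length S l)%:R / c <= n.
  move=> lF; apply/ltW; apply: le_lt_trans n0n.
  by rewrite (big_fsetD1 l)//= lerDl sumr_ge0.
pose K := #|` A|%:R / phi n.
have K0 : 0 <= K by rewrite divr_ge0// ltW.
have K1 : 0 <= K * (c / C) by rewrite mulr_ge0// divr_ge0 ?ltW.
pose b l := (if l \in ~` [set` F] then (w c l)%:E * p l else 0)%E.
have b0 l : (0 <= b l)%E by rewrite /b; case: ifP.
have term l : ((#|` exits A l|%:R)%:E * p l <=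
    (K * (c / C))%:E * ((w c l)%:E * p l) + K%:E * b l)%E.
  have [near|far] := leP ((word_length S l)%:R / c) n.
    apply: (@le_trans _ _ ((K * (c / C))%:E * ((w c l)%:E * p l))%E).
      by rewrite muleA -EFinM lee_wpmul2r// lee_fin exits_near.
    by rewrite leeDl// mule_ge0.
  apply: (@le_trans _ _ (K%:E * b l)%E); last by rewrite leeDr// mule_ge0.
  rewrite /b mem_set; last by move=> /= /Fn; rewrite leNgt far.
  by rewrite muleA -EFinM lee_wpmul2r// lee_fin exits_far// ltW.
rewrite -lee_pdivlMl//; apply: le_trans (le_esum (fun l _ => term l)) _.
rewrite esumD; last 2 first.
- by move=> l _; rewrite mule_ge0.
- by move=> l _; rewrite mule_ge0.
apply: le_trans (leeD (esum_mulr_le K1 a0) (esum_mulr_le K0 b0)) _.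
rewrite IJ /b -esum_mkcond.
apply: (@le_trans _ _ ((K * (c / C))%:E * J%:E + K%:E * (e / 2)%:E)%E).
  by rewrite leeD2l// lee_wpmul2l.
rewrite -!EFinM -EFinD lee_fin.
have -> : (phi n)^-1 * (e * #|` A|%:R) = K * (e / 2) + K * (e / 2).
  by rewrite /K; field; rewrite gt_eqF.
rewrite lerD2r -mulrA ler_wpM2l//.
rewrite mulrAC ler_pdivrMr//.
apply: (@le_trans _ _ (e / 2 * (c * J * 2 / e))).
  by rewrite le_eqVlt; apply/orP; left; apply/eqP; field; rewrite gt_eqF.
apply: ler_wpM2l; first by apply: divr_ge0 => //; exact: ltW.
by apply: le_trans C0C; rewrite lerDl.
Qed.

(** Since every C >= C0 is allowed, one C serves all of r by taking maxima, although c varies with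
    g. *)
Lemma sum_exits_scale (G : Type) (p : G -> L -> \bar R) (r : seq G) (e : R) :
  (forall g l, 0 <= p g l)%E ->
  (forall g, exists2 c : R, 0 < c &
    (\esum_(l in [set: L]) ((w c l)%:E * p g l) < +oo)%E) -> 0 < e ->
  exists2 C0 : R, 0 < C0 & forall C : R, C0 <= C -> exists2 n0 : R, 0 <= n0 &
  forall (n : R) A, n0 < n -> almost_invariant (C * n) A ->
  ((phi n)%:E * (\sum_(g <- r)
      \esum_(l in [set: L]) ((#|` exits A l|%:R)%:E * p g l)) <=
   (e * #|` A|%:R)%:E)%E.
Proof.
move=> p0 pfin; elim: r e => [|g r IH] e e0.
  exists 1 => // C _; exists 0 => // n A _ _.
  by rewrite big_nil mule0 lee_fin mulr_ge0// ltW.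
have e2 : 0 < e / 2 by rewrite divr_gt0.
have [C1 C1_gt0 H1] := IH _ e2.
have [c c0 cfin] := pfin g.
have [C2 C2_gt0 H2] := exits_scale (p0 g) c0 cfin e2.
exists (Num.max C1 C2); first by rewrite lt_max C1_gt0.
move=> C; rewrite ge_max => /andP[/H1[n1 n1_ge0 {}H1] /H2[n2 n2_ge0 {}H2]].
exists (Num.max n1 n2); first by rewrite le_max n1_ge0.
move=> n A; rewrite gt_max => /andP[n1n n2n] Ainv.
rewrite big_cons ge0_muleDr ?esum_ge0//; last 2 first.
- by move=> l _; rewrite mule_ge0.
- by apply: sume_ge0 => h _; apply: esum_ge0 => l _; rewrite mule_ge0.
apply: le_trans (leeD (H2 n A n2n Ainv) (H1 n A n1n Ainv)) _.
by rewrite -EFinD lee_fin -mulrDl -splitr.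
Qed.

End ExitScaling.

(** * Comparison of the Foelner functions *)

(** Weak monotonicity of t / phi(t) lets this cover both cases of the theorem: for phi(t) = t the
    ratio is constant. *)
Lemma folner_comp_le (R : realType) (Gam Lam : groupType)
    (SG : {fset Gam}) (SL : {fset Lam})
    (hSG : finite_symmetric_generating SG)
    (hSL : finite_symmetric_generating SL)
    (hSG0 : SG != fset0) (phi : R -> R)
    (phi_pos : forall t : R, 0 < t -> 0 < phi t)
    (phi0_ge0 : 0 <= phi 0)
    (phi_nondecr : forall s t : R, 0 < s -> s <= t -> phi s <= phi t)
    (ratio_nondecr :
      forall s t : R, 0 < s -> s <= t -> s / phi s <= t / phi t)
    (c : me_coupling R Gam Lam) (c_int : phi_integrable c SL phi) :
  asymp_le (@folner Gam R SG \o phi) (@folner Lam R SL).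
Proof.
have cG := countable_generated hSG; have cL := countable_generated hSL.
have [Om [mOm Om0 OmG OmL [YP XP freeL fundL]]] := strict_coupling c cG cL.
have aGP := me_actGP c; have aLP := me_actLP c.
have aG_mu := me_preservesG c; have aL_mu := me_preservesL c.
pose X := me_domL c `&` Om.
pose mu := me_measure c.
pose p := transition mu (me_actG c) (me_actL c) X.
have mX : measurable X by case: XP.
have X_fin : (mu X < +oo)%E.
  have [mdL _] := me_domLP c.
  apply: le_lt_trans (me_domL_fin c); apply: le_measure; rewrite ?inE//.
  exact: subIsetl.
have [v muX] : exists v, mu X = v%:E.
  by exists (fine (mu X)); rewrite fineK// ge0_fin_numE.
(* If X were null, so would be its countably many translates, which cover the conull set Om, and mu
   would vanish. *)
have v_gt0 : 0 < v.
  rewrite -lte_fin -muX lt_neqAle measure_ge0 andbT; apply/negP => /eqP X0.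
  suff : mu setT = 0 by exact: (@me_nonzero _ _ _ c).
  apply: measure_negligible => //.
  rewrite -(setvU Om); apply: negligibleU.
    by apply/negligibleP => //; exact: measurableC.
  have sub : Om `<=` \bigcup_l (me_actL c l @^-1` X).
    by move=> x Omx; case: XP => _ _ /(_ x Omx)[l lx] _; exists l.
  apply: (negligibleS sub); apply: negligible_countable_bigcup => // l.
  apply/negligibleP; first exact: (measurable_act aL_mu).
  exact: etrans (measure_act aL_mu l mX) (esym X0).
have p_fin g : exists2 cg, 0 < cg & (\esum_(l in [set: Lam])
    ((phi ((word_length SL l)%:R / cg))%:E * p g l) < +oo)%E.
  have [cg cg0 intg] := c_int g; exists cg => //; apply: le_lt_trans intg.
  apply: (transition_esum_le mOm OmG OmL freeL fundL) => l.
  exact: (phi_word_ge0 SL phi_pos phi0_ge0).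
have v8 : 0 < v / 8 by rewrite divr_gt0.
have p0 g l : (0 <= p g l)%E by exact: measure_ge0.
have [C C_gt0 /(_ C (lexx _)) [n0 n0_ge0 scale]] :=
  sum_exits_scale hSL phi_pos phi0_ge0 phi_nondecr ratio_nondecr SG p0 p_fin v8.
have [m mle] := excess_small cG aGP aG_mu YP XP X_fin v8.
(* The transferred set has at most 2 m |A| points; the successor keeps the constant positive when m
   = 0. *)
exists C => //; exists (2 * m).+1%:R; first by rewrite ltr0n.
exists n0; split; first exact: num_real.
move=> n n0n; have n_gt0 : 0 < n by exact: le_lt_trans n0n.
have N_gt0 := phi_pos n n_gt0.
rewrite /= -lee_pdivrMl ?ltr0n//.
apply: le_ereal_inf_tmp => _ [A Ainv <-]; rewrite lee_pdivrMl ?ltr0n//.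
have a_gt0 : (0 : R) < #|` A|%:R by case: Ainv => A0 _; rewrite ltr0n cardfs_gt0.
(* D = 2 phi(n) absorbs the factor 2 of [card_boundary_exits]. With v / 8 for both errors the left
   side is at most |A| v / 2. *)
have bound : ((2 * phi n)%:E * (\sum_(g <- SG)
     \esum_(l in [set: Lam]) ((#|` exits A l|%:R)%:E * p g l))
   + (2 * #|` A|%:R)%:E * mu (excess R (me_actG c) X m)
   < (#|` A|%:R)%:E * mu X)%E.
  rewrite [(2 * phi n)%:E]EFinM -muleA.
  apply: (@le_lt_trans _ _ (2%:E * (v / 8 * #|` A|%:R)%:E
      + (2 * #|` A|%:R)%:E * (v / 8)%:E)%E).
    apply: leeD.
      by rewrite lee_wpmul2l// scale.
    by rewrite lee_wpmul2l// lee_fin mulr_ge0.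
  rewrite muX -!EFinM -EFinD lte_fin; nra.
have comm g l x : me_actG c g (me_actL c l x) = me_actL c l (me_actG c g x) :=
  me_commute g l x.
have D_ge0 : 0 <= 2 * phi n by rewrite mulr_ge0// ltW.
have [B [B0 Bm BD]] := folner_transfer cG cL aGP aLP aG_mu aL_mu comm
  OmG OmL YP XP X_fin D_ge0 bound.
have b_gt0 : (0 : R) < #|` B|%:R by rewrite ltr0n cardfs_gt0.
apply: (@le_trans _ _ (#|` B|%:R)%:E).
  apply: ereal_inf_lbound; exists B => //; split => //.
  rewrite ler_pdivrMr// mulrAC mul1r ler_pdivlMr//.
  apply: le_trans BD; rewrite -mulrA mulrCA [leLHS]mulrC.
  apply: ler_wpM2l; first exact: ltW.
  rewrite -natr_sum -(natrM _ 2) ler_nat mul2n.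
  exact: card_boundary_exits.
rewrite -EFinM lee_fin -natrM ler_nat (leq_trans Bm)//.
by rewrite leq_mul2r leqnSn orbT.
Qed.

Theorem corollary2 (R : realType) (Gam Lam : groupType)
    (SG : {fset Gam}) (SL : {fset Lam})
    (hSG : finite_symmetric_generating SG)
    (hSL : finite_symmetric_generating SL)
    (* for nontrivial [Gam] this follows from [hSG] *)
    (hSG0 : SG != fset0)
    (* [phi] is a function on (0, +oo), extended at 0 by any value in [0, inf phi] *)
    (phi : R -> R)
    (phi_pos : forall t : R, 0 < t -> 0 < phi t)
    (phi_nondecr : forall s t : R, 0 < s -> s <= t -> phi s <= phi t)
    (phi0_ge0 : 0 <= phi 0)
    (phi0_le : forall t : R, 0 < t -> phi 0 <= phi t)
    (hcoupling : exists c : me_coupling R Gam Lam, phi_integrable c SL phi) :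
  ((forall t : R, 0 < t -> phi t = t) ->
     asymp_le (@folner Gam R SG) (@folner Lam R SL))
  /\
  ((forall s t : R, 0 < s -> s < t -> phi s < phi t) ->
   (forall s t : R, 0 < s -> s < t -> s / phi s < t / phi t) ->
     asymp_le (@folner Gam R SG \o phi) (@folner Lam R SL)).
Proof.
case: hcoupling => c c_int; split=> [phiE|_ ratio_incr]; last first.
  apply: (folner_comp_le hSG hSL hSG0 phi_pos phi0_ge0 phi_nondecr _ c_int).
  move=> s t s0; rewrite le_eqVlt => /predU1P[->//|st].
  exact/ltW/ratio_incr.
have ratio (s t : R) : 0 < s -> s <= t -> s / phi s <= t / phi t.
  move=> s0 st; have t0 : 0 < t by exact: lt_le_trans st.
  by rewrite !phiE// !divff// gt_eqF.
have [C C0 [K K0 [n0 [n0r H]]]] :=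
  folner_comp_le hSG hSL hSG0 phi_pos phi0_ge0 phi_nondecr ratio c_int.
(* The maximum with 0 ensures n > 0, where phi(n) = n is known. *)
exists C => //; exists K => //; exists (Num.max n0 0).
split=> [|n]; first exact: num_real.
by rewrite gt_max => /andP[n0n n_gt0]; rewrite -[n in folner _ n]phiE//; exact: H.
Qed.
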